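(* For every $m\in\mathbb{N}_0$, the pattern $P=\{0,1,2,\dots,m\}$ is positive definite completable.
   Context: $\mathbb{N}_0=\{0,1,2,\dots\}$. For a real sequence $\{s_k\}_{k\in\mathbb{N}_0}$ let $H_n=[s_{i+j}]_{i,j=0}^{n}$ be its Hankel matrices, $n\in\mathbb{N}_0$. The sequence is positive if $H_n$ is positive semidefinite for all $n$; it is a positive definite sequence if $H_n$ is positive definite for all $n$; it is a positive semidefinite sequence if it is positive but not positive definite. A partial sequence is a sequence $\{s_k\}_{k\in\mathbb{N}_0}$ in which some terms are specified real numbers while the remaining terms are unspecified (free real variables). Its pattern is $P=\{k\in\mathbb{N}_0 : s_k \text{ is specified}\}$. A partial sequence is partial positive definite if, for every $n\in\mathbb{N}_0$, each fully specified principal submatrix of $H_n$ is positive definite. A positive completion (Hamburger moment completion) of a partial sequence is a choice of real values for the unspecified terms such that the resulting sequence is positive definite or positive semidefinite (i.e. positive). A pattern $P$ is positive definite completable if every partial positive definite sequence with pattern $P$ has a positive completion. *)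

(* Defs.v *)
From mathcomp Require Import all_boot all_order all_algebra.
From mathcomp Require Import classical_sets reals.

Set Implicit Arguments.
Unset Strict Implicit.
Unset Printing Implicit Defensive.

Import Order.TTheory GRing.Theory Num.Theory.

Local Open Scope classical_set_scope.
Local Open Scope ring_scope.

Section Matrices.
Variable R : realType.

Definition psdmx n (A : 'M[R]_n) : Prop :=
  A^T = A /\ forall x : 'rV[R]_n, 0 <= (x *m A *m x^T) 0 0.

Definition pdmx n (A : 'M[R]_n) : Prop :=
  A^T = A /\ forall x : 'rV[R]_n, x != 0 -> 0 < (x *m A *m x^T) 0 0.

End Matrices.

(* The matrix [s_(i+j)] with 0 <= i, j <= n, hence of order n.+1; the entry
   type is arbitrary so that it applies to partial sequences as well. *)
Definition hankel (T : Type) (s : nat -> T) n : 'M[T]_n.+1 :=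
  \matrix_(i, j) s (i + j)%N.

(* Rows and columns are taken in the increasing order of A. *)
Definition principal_submx (T : Type) n (M : 'M[T]_n) (A : {set 'I_n}) :
    'M[T]_#|A| :=
  mxsub enum_val enum_val M.

Section Sequences.
Variable R : realType.

Definition positive_seq (s : nat -> R) : Prop := forall n, psdmx (hankel s n).

Definition pd_seq (s : nat -> R) : Prop := forall n, pdmx (hankel s n).

Definition psd_seq (s : nat -> R) : Prop := positive_seq s /\ ~ pd_seq s.

(* A partial sequence is a map s : nat -> option R, where s k = None means that
   the term of index k is unspecified. *)
Definition seq_pattern (s : nat -> option R) : set nat := [set k | isSome (s k)].

Definition fully_specified n (M : 'M[option R]_n) : Prop :=
  forall i j, isSome (M i j).

(* The default value 0 of odflt is never used, the submatrix being fully
   specified. *)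
Definition partial_pd (s : nat -> option R) : Prop :=
  forall n (A : {set 'I_n.+1}),
    let B := principal_submx (hankel s n) A in
    fully_specified B -> pdmx (map_mx (odflt 0) B).

Definition completion (s : nat -> option R) (t : nat -> R) : Prop :=
  forall k x, s k = Some x -> t k = x.

Definition positive_completion (s : nat -> option R) (t : nat -> R) : Prop :=
  completion s t /\ (pd_seq t \/ psd_seq t).

Definition pd_completable (P : set nat) : Prop :=
  forall s : nat -> option R, seq_pattern s = P -> partial_pd s ->
    exists t : nat -> R, positive_completion s t.

End Sequences.

Arguments pd_completable R P : clear implicits.

(* Main.v *)
Require Import Defs.
From mathcomp Require Import all_boot all_order all_algebra.
From mathcomp Require Import classical_sets reals.
From mathcomp Require Import ring zify.

(** The truncation [s_0, ..., s_m] makes the Hankel matrices of index at most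
    [m./2] positive definite. Once [H_n] is positive definite, the terms up to
    [s_(2n+1)] may be anything: writing [b = (s_(n+1), ..., s_(2n+1))] for the
    last row of [H_(n+1)] without its corner, the Schur complement of [H_n] in
    [H_(n+1)] is [s_(2n+2) - b H_n^-1 b^T], and choosing [s_(2n+2)] so that it
    equals 1 makes [H_(n+1)] positive definite. Iterating gives a positive
    definite completion. *)

Local Open Scope classical_set_scope.

Import Order.TTheory GRing.Theory Num.Theory.
Local Open Scope ring_scope.

Section Extension.
Set Implicit Arguments.
Unset Strict Implicit.
Variable R : realType.
Implicit Types s t : nat -> R.

Lemma tr_hankel t n : (hankel t n)^T = hankel t n.
Proof. by apply/matrixP => i j; rewrite !mxE addnC. Qed.

Lemma eq_hankel s t n :
  (forall k, (k <= n.*2)%N -> s k = t k) -> hankel s n = hankel t n.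
Proof.
move=> st; apply/matrixP => i j; rewrite !mxE; apply: st.
by have := ltn_ord i; have := ltn_ord j; lia.
Qed.

Lemma mx_formE n (A : 'M[R]_n) (x : 'rV[R]_n) :
  (x *m A *m x^T) 0 0 = \sum_i \sum_j x 0 i * x 0 j * A i j.
Proof.
rewrite mxE exchange_big; apply: eq_bigr => j _.
by rewrite !mxE mulr_suml; apply: eq_bigr => i _; ring.
Qed.

Lemma pdmx_unit n (A : 'M[R]_n) : pdmx A -> A \in unitmx.
Proof.
case=> _ A_gt0; rewrite -row_free_unit -kermx_eq0.
apply/eqP/row_matrixP => i; rewrite row0; apply/eqP.
case: eqVneq => // /A_gt0; have /sub_kermxP -> := row_sub i (kermx A).
by rewrite mul0mx mxE ltxx.
Qed.

Lemma pdmx_ge0 n (A : 'M[R]_n) (x : 'rV[R]_n) :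
  pdmx A -> 0 <= (x *m A *m x^T) 0 0.
Proof.
case=> _ A_gt0; have [->|/A_gt0/ltW //] := eqVneq x 0.
by rewrite !mul0mx mxE.
Qed.

Definition hankel_border t n : 'rV[R]_n.+1 := \row_j t (n.+1 + j)%N.

Definition hankel_extend t n : nat -> R := fun k =>
  if k == n.*2.+2 then
    1 + (hankel_border t n *m invmx (hankel t n) *m (hankel_border t n)^T) 0 0
  else t k.

Lemma hankel_extend_neq t n k : k != n.*2.+2 -> hankel_extend t n k = t k.
Proof. by rewrite /hankel_extend => /negbTE ->. Qed.

(** Completing the square: for [x = (x', a)] and [b] the border, the form is [x' H x'^T + 2 a x' b^T
    + a^2 (1 + b H^-1 b^T)]. Shifting [x'] by [a b H^-1] absorbs the cross terms and leaves [a^2]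
    times the Schur complement 1. *)
Lemma hankel_extend_form t n (x : 'rV[R]_n.+2) : pdmx (hankel t n) ->
  let a := x 0 ord_max in
  let y := \row_(i < n.+1) x 0 (widen_ord (leqnSn n.+1) i)
           + a *: (hankel_border t n *m invmx (hankel t n)) in
  (x *m hankel (hankel_extend t n) n.+1 *m x^T) 0 0 =
  (y *m hankel t n *m y^T) 0 0 + a ^+ 2.
Proof.
move=> Hpd /=.
set a := x 0 ord_max; set x' := \row_i _; set b := hankel_border t n.
set H := hankel t n; set v := b *m invmx H.
(* These two identities remove [H] from every term of the expanded right side except [x' H x'^T]. *)
have vH : v *m H = b by rewrite /v mulmxKV // pdmx_unit.
have Hv : H *m v^T = b^T by rewrite -vH [RHS]trmx_mul [H^T]tr_hankel.
rewrite [(_ + _)^T]linearD /= [(_ *: _)^T]linearZ /=.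
rewrite mulmxDl -scalemxAl vH mulmxDl !mulmxDr -!scalemxAr -!scalemxAl.
rewrite -(mulmxA x' H v^T) Hv.
have trE (A : 'M[R]_1) : A 0 0 = A^T 0 0 by rewrite mxE.
have bx : (b *m x'^T) 0 0 = (x' *m b^T) 0 0.
  by rewrite [RHS]trE [in RHS]trmx_mul trmxK.
have bv : (b *m v^T) 0 0 = (v *m b^T) 0 0.
  by rewrite [RHS]trE [in RHS]trmx_mul trmxK.
have xb : (x' *m b^T) 0 0 =
    \sum_(i < n.+1) x 0 (widen_ord (leqnSn n.+1) i) * t (n.+1 + i)%N.
  by rewrite mxE; apply: eq_bigr => i _; rewrite !mxE.
have entryE (A B C D : 'M[R]_1) :
    (A + a *: B + (a *: C + a *: (a *: D))) 0 0 =
    A 0 0 + a * B 0 0 + (a * C 0 0 + a * (a * D 0 0)) by rewrite !mxE.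
rewrite entryE bx bv.
(* The left side splits into the leading block, last column, last row and corner. Only the corner
   has index sum [2n+2], so the other three still read [t]. *)
rewrite [LHS]mx_formE [LHS]big_ord_recr /=.
under eq_bigr do rewrite big_ord_recr /=.
rewrite big_split /= [X in _ + _ + X = _]big_ord_recr /= -/a.
have -> : \sum_(i < n.+1) \sum_(j < n.+1)
    x 0 (widen_ord (leqnSn n.+1) i) * x 0 (widen_ord (leqnSn n.+1) j) *
    hankel (hankel_extend t n) n.+1 (widen_ord (leqnSn n.+1) i)
      (widen_ord (leqnSn n.+1) j) = (x' *m H *m x'^T) 0 0.
  rewrite mx_formE; apply: eq_bigr => i _; apply: eq_bigr => j _.
  rewrite !mxE /= hankel_extend_neq //.
  by have := ltn_ord i; have := ltn_ord j; lia.
have -> : \sum_(i < n.+1) x 0 (widen_ord (leqnSn n.+1) i) * a *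
    hankel (hankel_extend t n) n.+1 (widen_ord (leqnSn n.+1) i) ord_max =
    a * (x' *m b^T) 0 0.
  rewrite xb mulr_sumr; apply: eq_bigr => i _.
  rewrite !mxE /= hankel_extend_neq; last by have := ltn_ord i; lia.
  by rewrite (addnC i); ring.
have -> : \sum_(i < n.+1) a * x 0 (widen_ord (leqnSn n.+1) i) *
    hankel (hankel_extend t n) n.+1 ord_max (widen_ord (leqnSn n.+1) i) =
    a * (x' *m b^T) 0 0.
  rewrite xb mulr_sumr; apply: eq_bigr => i _.
  rewrite !mxE /= hankel_extend_neq; last by have := ltn_ord i; lia.
  by ring.
have -> : hankel (hankel_extend t n) n.+1 ord_max ord_max =
    1 + (v *m b^T) 0 0.
  by rewrite mxE /hankel_extend /= addSn addnS addnn eqxx.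
by ring.
Qed.

Lemma pdmx_hankel_extend t n :
  pdmx (hankel t n) -> pdmx (hankel (hankel_extend t n) n.+1).
Proof.
move=> Hpd; split; first exact: tr_hankel.
move=> x x_neq0; rewrite hankel_extend_form //.
(* If [a] is nonzero, [a^2] is already positive. If [a = 0], the shift vanishes and the truncation
   of [x] is nonzero because [x] is. *)
have [a0|a_neq0] := eqVneq (x 0 ord_max) 0; last first.
  by rewrite ltr_wpDl ?pdmx_ge0 // exprn_even_gt0.
rewrite a0 scale0r addr0 expr0n addr0.
apply: Hpd.2; apply: contraNneq x_neq0 => x'0.
apply/eqP/rowP => i; rewrite [RHS]mxE.
have [lt_in|le_ni] := ltnP i n.+1.
  move/rowP/(_ (Ordinal lt_in)): x'0; rewrite !mxE => <-.
  by congr (x 0 _); apply: val_inj.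
by rewrite -[RHS]a0; congr (x 0 _); apply: val_inj => /=; have := ltn_ord i; lia.
Qed.

Fixpoint hankel_iter t n k : nat -> R :=
  if k is k'.+1 then hankel_extend (hankel_iter t n k') (n + k') else t.

Lemma pdmx_hankel_iter t n k :
  pdmx (hankel t n) -> pdmx (hankel (hankel_iter t n k) (n + k)).
Proof.
move=> Hpd; elim: k => [|k IH]; first by rewrite addn0.
by rewrite addnS; apply: pdmx_hankel_extend.
Qed.

(** Passing from stage [d] to [d+1] changes only the term [2(n+d)+2], which lies beyond [2(n+k)+1]
    once [d >= k]. *)
Lemma hankel_iter_stable t n k l i : (k <= l)%N -> (i <= (n + k).*2.+1)%N ->
  hankel_iter t n l i = hankel_iter t n k i.
Proof.
move=> le_kl le_i; rewrite -(subnK le_kl); elim: (l - k)%N => //= d IH.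
by rewrite hankel_extend_neq //; lia.
Qed.

(** The bound is [2n+1] and not [2n] because the first modified term is the corner [2n+2]; the term
    [2n+1] belongs to the border, which is arbitrary. *)
Lemma pd_seq_extension t n : (forall i, (i <= n)%N -> pdmx (hankel t i)) ->
  exists2 u, (forall i, (i <= n.*2.+1)%N -> u i = t i) & pd_seq u.
Proof.
(* The diagonal is the pointwise limit of the stages: term [i] is final at stage [i], since
   [i <= 2(n+i)+1]. *)
move=> Hpd; exists (fun i => hankel_iter t n i i).
  by move=> i le_i; rewrite (@hankel_iter_stable t n 0) ?addn0.
move=> i; have [le_in|/ltnW le_ni] := leqP i n.
  rewrite (_ : hankel _ i = hankel t i); first exact: Hpd.
  apply: eq_hankel => k le_k.
  by rewrite (@hankel_iter_stable t n 0) ?addn0 //; lia.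
(* Stage [i - n] makes the matrix of index [i] positive definite, and its terms up to [2i] are final
   there. *)
rewrite (_ : hankel _ i = hankel (hankel_iter t n (i - n)) i).
  by have := pdmx_hankel_iter (i - n) (Hpd n (leqnn n)); rewrite subnKC.
apply: eq_hankel => k le_k.
have [le_kin|/ltnW le_ink] := leqP k (i - n).
  by rewrite (@hankel_iter_stable t n k (i - n)) //; lia.
by rewrite (@hankel_iter_stable t n (i - n)) //; lia.
Qed.

(** The enumeration [e] of the full index set is a bijection, so it merely permutes the variables of
    the quadratic form. *)
Lemma pdmx_principal_setT n (A : 'M[R]_n) :
  pdmx (principal_submx A [set: 'I_n]%SET) -> pdmx A.
Proof.
set e := @enum_val _ (mem [set: 'I_n]%SET).
have e_bij : bijective e.
  by apply: inj_card_bij; rewrite ?cardsT ?card_ord //; apply: enum_val_inj.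
case=> A_sym A_gt0; have [e' _ e'K] := e_bij; split.
  apply/matrixP => i j; move/matrixP/(_ (e' i) (e' j)): A_sym.
  by rewrite !mxE -/e !e'K.
move=> x x_neq0; have ex_neq0 : colsub e x != 0.
  apply: contraNneq x_neq0 => /rowP ex0; apply/eqP/rowP => i.
  by move: (ex0 (e' i)); rewrite !mxE e'K.
have reindex_e (F : 'I_n -> R) : \sum_i F i = \sum_i F (e i).
  by apply: reindex; apply: onW_bij.
rewrite mx_formE reindex_e; under eq_bigr do rewrite reindex_e.
have := A_gt0 _ ex_neq0; rewrite mx_formE; congr (0 < _).
by apply: eq_bigr => i _; apply: eq_bigr => j _; rewrite !mxE.
Qed.

Lemma partial_pd_hankel (s : nat -> option R) n :
  (forall k, (k <= n.*2)%N -> s k) -> partial_pd s ->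
  pdmx (hankel (odflt 0 \o s) n).
Proof.
move=> s_spec /(_ n [set: 'I_n.+1]%SET) /= s_pd.
apply: pdmx_principal_setT.
rewrite (_ : principal_submx _ _ =
  map_mx (odflt 0) (principal_submx (hankel s n) [set: 'I_n.+1]%SET)).
  apply: s_pd => i j; rewrite !mxE; apply: s_spec.
  by rewrite -addnn leq_add // -ltnS.
by apply/matrixP => i j; rewrite !mxE.
Qed.

End Extension.

Local Close Scope ring_scope.

Theorem corollary3p9 (R : realType) (m : nat) :
  pd_completable R [set k : nat | (k <= m)%N].
Proof.
move=> s sP s_pd.
have s_spec k : (s k : bool) = (k <= m)%N.
  by apply/idP/idP => [sk|km]; [have : seq_pattern s k | have : [set k | (k <= m)%N] k];
    rewrite ?sP // -sP.
(* [m./2] is the largest [n] with [2n <= m], so these matrices read no default value. As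
   [m <= 2(m./2)+1], all specified terms are kept; for even [m], the term [m+1] takes the default 0,
   an admissible border entry. *)
have [|t ts t_pd] := @pd_seq_extension R (odflt 0%R \o s) m./2.
  move=> i le_i; apply: partial_pd_hankel => // k le_k.
  by rewrite s_spec; lia.
exists t; split; last by left.
move=> k x skx; rewrite ts /= ?skx //.
have : s k by rewrite skx.
by rewrite s_spec; lia.
Qed.
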